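(* Let $\mathcal{S}_n$ be the number of triangles incident with the vertex $v_{n,1}$ in a uniformly random triangulation $\mathcal{T}_n$ of the regular $n$-gon $P_n$ (equivalently, for $n\geq 3$, $\mathcal{S}_n=\mathcal{D}_{n,1}+1$, where $\mathcal{D}_{n,1}$ is the number of diagonals of $\mathcal{T}_n$ incident with $v_{n,1}$), and let $g_n(z)=\mathbb{E}(z^{\mathcal{S}_n})$. Then: 1. For $n\ge 4$, $$g_n(z)=\frac{1}{C_{n-2}}\sum_{s=1}^{n-2}\frac{s\,(2n-s-5)!}{(n-s-2)!\,(n-2)!}\,z^s.$$ 2. $\mathbb{E}(\mathcal{S}_n)=\dfrac{3(n-2)}{n}$ for $n\ge 2$. 3. $\mathrm{Var}(\mathcal{S}_n)=\dfrac{2(2n-3)(n-2)(n-3)}{n^2(n+1)}$ for $n\ge 2$.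
   Context: $P_n$ has vertices $v_{n,1},\dots,v_{n,n}$ in cyclic order. A triangulation of $P_n$ is a set of $n-3$ noncrossing diagonals partitioning $P_n$ into $n-2$ triangles; there are $C_{n-2}$ of them, where $C_k=\frac{1}{k+1}\binom{2k}{k}$, and $\mathcal{T}_n$ is chosen uniformly among them. Equivalently, $\mathcal{S}_n=\sum_{\Delta\in\mathcal{T}_n}f_n(\Delta)$, where the weight of the triangle with vertices $v_{n,l},v_{n,j},v_{n,r}$, $l<j<r$, is $1$ if $l=1$ and $0$ otherwise. For $n=2$ the polygon is degenerate, with a single empty triangulation and $\mathcal{S}_2=0$. $z$ is a complex variable. *)

(* Defs.v *)
From HB Require Import structures.
From mathcomp Require Import all_boot all_order all_algebra.
From mathcomp Require Import reals.
From mathcomp.real_closed Require Import complex.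

Set Implicit Arguments.
Unset Strict Implicit.
Unset Printing Implicit Defensive.

Import Order.TTheory GRing.Theory Num.Theory.

Local Open Scope ring_scope.

(* The vertices v_{n,1}, ..., v_{n,n} of P_n, in cyclic order, are the elements
   0, ..., n-1 of 'I_n: v_{n,k} is the ordinal of value k-1.  A chord joining
   two distinct vertices is the pair (i, j) of its endpoints with i < j; as P_n
   is convex, two chords cross in the interior of P_n iff their endpoints
   strictly alternate in the cyclic order. *)
Section Polygon.
Variable n : nat.

Definition chord : finType := ('I_n * 'I_n)%type.

Definition adjacent (i j : 'I_n) : bool := (j == ordS i) || (i == ordS j).

Definition diagonal (d : chord) : bool :=
  (d.1 < d.2)%N && ~~ adjacent d.1 d.2.

Definition crossing (d e : chord) : bool :=
  [&& (d.1 < e.1)%N, (e.1 < d.2)%N & (d.2 < e.2)%N]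
  || [&& (e.1 < d.1)%N, (d.1 < e.2)%N & (e.2 < d.2)%N].

(* A triangle ((l, j), r) has vertices l < j < r. *)
Definition triangle : finType := ('I_n * 'I_n * 'I_n)%type.

Definition segment (T : {set chord}) (i j : 'I_n) : bool :=
  adjacent i j || ((i, j) \in T).

(* For noncrossing T these are exactly the triangular faces of the subdivision
   of P_n by T: since P_n is convex, a diagonal meeting the interior of a
   triangle with vertices among those of P_n crosses one of its sides. *)
Definition triangles (T : {set chord}) : {set triangle} :=
  [set t : triangle | let: (l, j, r) := t in
    [&& (l < j)%N, (j < r)%N, segment T l j, segment T j r & segment T l r]].

(* For n = 2 the truncated n - 3 is 0, so set0 is the only triangulation. *)
Definition is_triangulation (T : {set chord}) : bool :=
  [&& [forall d in T, diagonal d],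
      [forall d in T, forall e in T, ~~ crossing d e],
      #|T| == (n - 3)%N
    & #|triangles T| == (n - 2)%N].

Definition triangulations : {set {set chord}} :=
  [set T | is_triangulation T].

Definition is_v1 (i : 'I_n) : bool := val i == 0%N.

Definition num_triangles_v1 (T : {set chord}) : nat :=
  #|[set t in triangles T |
      let: (l, j, r) := t in [|| is_v1 l, is_v1 j | is_v1 r]]|.

Definition num_diagonals_v1 (T : {set chord}) : nat :=
  #|[set d in T | is_v1 d.1 || is_v1 d.2]|.

End Polygon.

(* Expectation of X with respect to the uniform distribution on the finite set
   A; F is the field of real or of complex numbers. *)
Definition unif_expectation (F : fieldType) (Omega : finType)
    (A : {set Omega}) (X : Omega -> F) : F :=
  (\sum_(w in A) X w) / #|A|%:R.

Definition unif_variance (F : fieldType) (Omega : finType)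
    (A : {set Omega}) (X : Omega -> F) : F :=
  unif_expectation A (fun w => (X w - unif_expectation A X) ^+ 2).

Definition catalan (F : fieldType) (k : nat) : F :=
  k.+1%:R^-1 * 'C(2 * k, k)%:R.

Definition mean_v1 (R : realType) (n : nat) : R :=
  unif_expectation (triangulations n) (fun T => (num_triangles_v1 T)%:R).

Definition var_v1 (R : realType) (n : nat) : R :=
  unif_variance (triangulations n) (fun T => (num_triangles_v1 T)%:R).

Definition pgf_v1 (R : realType) (n : nat) (z : R[i]) : R[i] :=
  unif_expectation (triangulations n) (fun T => z ^+ num_triangles_v1 T).

(* Main.v *)
(* Removing the triangle on the side v_1 v_n, with apex v_m, splits a
   triangulation into independent triangulations of the polygons v_1 ... v_m and
   v_m ... v_n, and the number of triangles at v_1 drops by one.  Hence the number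
   q(N, s) of triangulations of the (N+2)-gon with s triangles at v_1 satisfies
   q(N+1, s+1) = sum_a q(a, s) C_(N-a), which is also satisfied by the ballot
   numbers, characterised by q(N+1, s+1) = q(N, s) + q(N+1, s+2).  The latter
   recurrence yields the closed formula, and also
   sum_s s q(N, s) = C_(N+1) - C_N and
   sum_s s^2 q(N, s) = 2 C_(N+2) - 5 C_(N+1) + C_N. *)
Require Import Defs.
From HB Require Import structures.
From mathcomp Require Import all_boot all_order all_algebra.
From mathcomp Require Import reals.
From mathcomp.real_closed Require Import complex.
From mathcomp Require Import zify ring.

Set Implicit Arguments.
Unset Strict Implicit.
Unset Printing Implicit Defensive.

Import Order.TTheory GRing.Theory Num.Theory.

Local Open Scope nat_scope.

(* For N >= 1, [ballot N s] is s * (2N-s-1)! / ((N-s)! * N!), the number of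
   triangulations of the (N+2)-gon with s triangles at a given vertex. *)
Fixpoint ballot (N s : nat) : nat :=
  match N, s with
  | 0, _ => s == 0
  | _.+1, 0 => 0
  | N'.+1, s'.+1 => \sum_(s' <= t < N) ballot N' t
  end.

Lemma ballotSS N s : ballot N.+1 s.+1 = \sum_(s <= t < N.+1) ballot N t.
Proof. by []. Qed.

Lemma ballot_gt N s : N < s -> ballot N s = 0.
Proof. by case: N s => [|N] [|s] // ltNs; rewrite ballotSS big_geq. Qed.

Lemma ballot_rec N s :
  ballot N.+1 s.+1 = ballot N s + ballot N.+1 s.+2.
Proof.
have [leNs|ltsN] := leqP s N; first by rewrite !ballotSS big_ltn.
by rewrite !ballot_gt // ltnW.
Qed.

Lemma ballot_fact N s : s <= N.+1 ->
  ballot N.+1 s * (N.+1 - s)`! * N.+1`! = s * (2 * N + 1 - s)`!.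
Proof.
elim: N s => [|N IHN] s.
  by case: s => [|[|s]] // _; rewrite ballotSS big_nat1.
have [->|s_gt0] := posnP s; first by [].
move Dk: (N.+2 - s) => k; elim: k s Dk s_gt0 => [|k IHk] [//|s] Dk _ les.
  have Es : s = N.+1 by clear IHN; lia.
  rewrite {}Es in les *.
  rewrite ballotSS big_nat1 (_ : 2 * N.+1 + 1 - N.+2 = N.+1); last by lia.
  have := IHN N.+1 (leqnn _).
  rewrite (_ : 2 * N + 1 - N.+1 = N) ?subnn; last by lia.
  rewrite fact0 muln1 -factS => /eqP.
  rewrite -[X in _ == X]mul1n eqn_pmul2r ?fact_gt0 // => /eqP ->.
  by rewrite !mul1n -factS.
rewrite ballot_rec.
have H1 := IHN s ltac:(lia); have H2 := IHk s.+2 ltac:(lia) isT ltac:(lia).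
have E1 : N.+1 - s = k.+1 by lia.
have E2 : 2 * N.+1 + 1 - s.+1 = (2 * N + 1 - s).+1 by lia.
have E3 : 2 * N.+1 + 1 - s.+2 = 2 * N + 1 - s by lia.
rewrite E1 in H1; rewrite E3 in H2; rewrite E2.
rewrite mulnDl mulnDl [N.+2`!]factS.
have -> : ballot N.+1 s * k.+1`! * (N.+2 * N.+1`!) = N.+2 * (s * (2 * N + 1 - s)`!).
  by rewrite -H1; ring.
have -> : ballot N.+2 s.+2 * k.+1`! * (N.+2 * N.+1`!) = k.+1 * (s.+2 * (2 * N + 1 - s)`!).
  by rewrite -H2 !factS; ring.
rewrite [(_.+1)`!]factS !mulnA -mulnDl; congr (_ * _).
nia.
Qed.

Definition catalan_nat (N : nat) : nat := ballot N.+1 1.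

Lemma sum_ballot N : \sum_(s < N.+1) ballot N s = catalan_nat N.
Proof. by rewrite /catalan_nat ballotSS big_mkord. Qed.

Lemma catalan_nat_fact N : catalan_nat N * N`! * N.+1`! = (2 * N)`!.
Proof. by have := @ballot_fact N 1 isT; rewrite subSS subn0 mul1n addnK. Qed.

Lemma catalan_nat_gt0 N : 0 < catalan_nat N.
Proof.
have := fact_gt0 (2 * N); rewrite -catalan_nat_fact.
by rewrite !muln_gt0 => /andP[/andP[]].
Qed.

Lemma catalan_natS N : N.+2 * catalan_nat N.+1 = 2 * (2 * N + 1) * catalan_nat N.
Proof.
have := catalan_nat_fact N.+1.
have -> : (2 * N.+1)`! = (2 * N).+2 * ((2 * N).+1 * (2 * N)`!).
  by rewrite -!factS; congr _`!; lia.
rewrite -catalan_nat_fact => E.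
have H : 0 < N`! * N.+1`! by rewrite muln_gt0 !fact_gt0.
have H' : 0 < N.+1 by [].
apply/eqP; rewrite -(eqn_pmul2r H) -(eqn_pmul2r H'); apply/eqP.
transitivity (catalan_nat N.+1 * N.+1`! * (N.+2 * N.+1`!)); first by rewrite !factS; ring.
by rewrite E; ring.
Qed.

Lemma ballot_conv N s :
  ballot N.+1 s.+1 = \sum_(a < N.+1) ballot a s * catalan_nat (N - a).
Proof.
elim: N s => [|N IHN] s.
  rewrite big_ord1; case: s => [|s]; first by rewrite (_ : ballot 0 0 = 1) // mul1n.
  by rewrite ballotSS big_geq.
case: s => [|s].
  rewrite big_ord_recl (_ : ballot 0 0 = 1) // mul1n subn0 big1 ?addn0 //.
move Dk: (N.+2 - s) => k; elim: k s Dk => [|k IHk] s Dk.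
  by rewrite ballot_gt ?big1 // => [[a lea] /= _|]; [rewrite ballot_gt //; lia|lia].
rewrite ballot_rec IHN IHk; last by lia.
rewrite [in RHS]big_ord_recl (_ : ballot 0 _ = 0) // mul0n add0n.
under [RHS]eq_bigr => a _ do rewrite lift0 ballot_rec mulnDl.
rewrite big_split [X in _ + X = _]big_ord_recl (_ : ballot 0 _ = 0) // mul0n add0n.
Qed.

Lemma sum_disjointU (I : finType) (A B : {set I}) (F : I -> nat) :
  [disjoint A & B] ->
  \sum_(x in A :|: B) F x = \sum_(x in A) F x + \sum_(x in B) F x.
Proof.
by move=> dAB; rewrite -bigU //; apply: eq_bigl => x; rewrite !inE.
Qed.

Section Triangulates.
Variable n : nat.
Implicit Types (i j m : 'I_n) (T : {set chord n}) (d : chord n).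

Definition within i j T : bool :=
  [forall d in T, [&& i <= d.1, d.1.+1 < d.2 & d.2 <= j]].

Definition noncrossing T : bool :=
  [forall d in T, forall e in T, ~~ crossing d e].

(* [T] triangulates the polygon with vertices i, i+1, ..., j.  The side (i, j)
   is counted as a member of [T] (when j > i+1), hence the cardinal j-i-1; with
   this convention the two polygons cut off by an apex are of the same kind. *)
Definition triangulates i j T : bool :=
  [&& within i j T, noncrossing T & #|T| == j - i - 1].

Definition edge T i j : bool := (j == i.+1 :> nat) || ((i, j) \in T).

Definition faces T : {set triangle n} :=
  [set t : triangle n | let: (l, m, r) := t in
    [&& l < m, m < r, edge T l m, edge T m r & edge T l r]].

Definition restr T i j : {set chord n} := [set d in T | (i <= d.1) && (d.2 <= j)].

Definition glue i j m T1 T2 : {set chord n} := (i, j) |: (T1 :|: T2).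

Lemma withinP i j T : reflect
  (forall d, d \in T -> [&& i <= d.1, d.1.+1 < d.2 & d.2 <= j]) (within i j T).
Proof. exact: 'forall_implyP. Qed.

Lemma noncrossingP T : reflect
  (forall d e, d \in T -> e \in T -> ~~ crossing d e) (noncrossing T).
Proof.
apply: (iffP 'forall_implyP) => [H d e dT eT|H d dT].
  by have /'forall_implyP := H d dT; apply.
by apply/'forall_implyP => e; apply: H.
Qed.

Lemma noncrossingS T T' : T' \subset T -> noncrossing T -> noncrossing T'.
Proof.
move=> /subsetP sT /noncrossingP H; apply/noncrossingP => d e dT eT.
by apply: H; apply: sT.
Qed.

Lemma within_restr i j a b T : within i j T -> within a b (restr T a b).
Proof.
move=> /withinP H; apply/withinP => d; rewrite inE => /andP[/H].
by lia.
Qed.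

Lemma restr_noncrossing a b T : noncrossing T -> noncrossing (restr T a b).
Proof. by apply: noncrossingS; apply/subsetP => d; rewrite inE => /andP[]. Qed.

(* The witness is the largest m < j joined to i. *)
Lemma split_vertex i j T : i.+1 < j -> within i j T -> noncrossing T ->
  exists2 m : 'I_n, i < m < j &
    edge T i m /\ forall d, d \in T -> d != (i, j) -> (d.2 <= m) || (m <= d.1).
Proof.
move=> ltij /withinP wT /noncrossingP ncT.
have lt1 : i.+1 < n by apply: leq_trans ltij (ltnW (ltn_ord j)).
pose P (m : 'I_n) := (i < m < j) && edge T i m.
have P0 : P (Ordinal lt1) by rewrite /P /edge /= eqxx ltnSn ltij.
case: (@arg_maxnP _ _ P (@nat_of_ord n) P0) => m /andP[imj im] max_m.
exists m => //; split=> // [[a b]] dT /=.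
have /= := wT _ dT; move=> /and3P[ia ab bj].
rewrite xpair_eqE negb_and -!val_eqE /= => ne.
rewrite leqNgt [m <= a]leqNgt -negb_and; apply/negP => /andP[mb am].
have [eai|neai] := eqVneq a i.
  have : P b by rewrite /P /edge -eai dT orbT andbT; move: ne; rewrite eai; lia.
  by move=> /max_m; lia.
have imT : (i, m) \in T.
  by case/orP: im => // /eqP em; move: neai; rewrite -val_eqE /=; lia.
have := ncT _ _ imT dT; rewrite /crossing /= negb_or => /andP[/negP] [].
by move: neai; rewrite -val_eqE /=; lia.
Qed.

Lemma card_split i j m T : within i j T -> i < m < j ->
  (forall d, d \in T -> d != (i, j) -> (d.2 <= m) || (m <= d.1)) ->
  T :\ (i, j) = restr T i m :|: restr T m j /\
  #|T| = ((i, j) \in T) + #|restr T i m| + #|restr T m j|.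
Proof.
move=> /withinP wT imj H.
have E : T :\ (i, j) = restr T i m :|: restr T m j.
  apply/setP => [[a b]]; rewrite !inE.
  have [dT|] /= := boolP ((a, b) \in T); last by rewrite andbF.
  have /= := wT _ dT; rewrite andbT; have := H _ dT.
  rewrite xpair_eqE -!val_eqE /= => H' w.
  apply/idP/idP => [/H'|]; lia.
split=> //; rewrite (cardsD1 (i, j)) -addnA E cardsU.
rewrite [X in _ - X](_ : _ = 0) ?subn0 //; apply/eqP; rewrite cards_eq0.
apply/eqP/setP => [[a b]]; rewrite !inE; apply/negP.
by move=> /andP[/andP[/wT /=]]; lia.
Qed.

Lemma card_within i j T : i < j -> within i j T -> noncrossing T ->
  #|T| <= j - i - 1 /\ ((i, j) \notin T -> i.+1 < j -> #|T| < j - i - 1).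
Proof.
move Dk: (j - i) => k; elim/ltn_ind: k => k IH in i j T Dk *.
move=> ltij wT ncT; have [ltij1|leji] := ltnP i.+1 j; last first.
  split=> //; rewrite (_ : T = set0) ?cards0 //; apply/setP => d; rewrite inE.
  by apply/negP; move/withinP: wT => wT /wT; lia.
have [m imj [_ H]] := split_vertex ltij1 wT ncT.
have [_ cT] := card_split wT imj H.
have w1 := within_restr i m wT; have w2 := within_restr m j wT.
have n1 := restr_noncrossing i m ncT; have n2 := restr_noncrossing m j ncT.
have [||b1 _] := IH (m - i) _ i m _ erefl _ w1 n1; try lia.
by have [||b2 _] := IH (j - m) _ m j _ erefl _ w2 n2; lia.
Qed.

Lemma triangulates_edge i j T : i < j -> triangulates i j T -> edge T i j.
Proof.
move=> ltij /and3P[wT nT /eqP cT]; apply: contraT; rewrite negb_or => /andP[ne nin].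
by have [_ /(_ nin)] := card_within ltij wT nT; lia.
Qed.

Lemma triangulates_restr i j T : i.+1 < j -> triangulates i j T ->
  exists2 m : 'I_n, i < m < j &
    [/\ triangulates i m (restr T i m), triangulates m j (restr T m j)
    & T = glue i j m (restr T i m) (restr T m j)].
Proof.
move=> ltij clT; have := triangulates_edge (ltnW ltij) clT.
have /and3P[wT nT /eqP cT] := clT.
move=> /orP[/eqP|ijT]; first by lia.
have [m imj [_ H]] := split_vertex ltij wT nT; exists m => //.
have [E] := card_split wT imj H; rewrite cT ijT => c.
have w1 := within_restr i m wT; have w2 := within_restr m j wT.
have n1 := restr_noncrossing i m nT; have n2 := restr_noncrossing m j nT.
have [|b1 _] := card_within _ w1 n1; first by lia.
have [|b2 _] := card_within _ w2 n2; first by lia.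
split; last by rewrite /glue -E setD1K.
  by apply/and3P; split=> //; apply/eqP; lia.
by apply/and3P; split=> //; apply/eqP; lia.
Qed.

Lemma face_within i j T a b c : within i j T ->
  (a, b, c) \in faces T -> [&& i <= a, a < b, b < c & c <= j].
Proof.
move=> /withinP w; rewrite inE => /and5P[ab bc _ _ /orP[/eqP|/w /=]]; lia.
Qed.

Section Glue.
Variables (i j m : 'I_n) (T1 T2 : {set chord n}).
Hypotheses (imj : i < m < j) (cl1 : triangulates i m T1) (cl2 : triangulates m j T2).

Let w1 d : d \in T1 -> [&& i <= d.1, d.1.+1 < d.2 & d.2 <= m].
Proof. by have /and3P[/withinP w _ _] := cl1; apply: w. Qed.

Let w2 d : d \in T2 -> [&& m <= d.1, d.1.+1 < d.2 & d.2 <= j].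
Proof. by have /and3P[/withinP w _ _] := cl2; apply: w. Qed.

Let notin1 (a b : 'I_n) : ~~ [&& i <= a, a.+1 < b & b <= m] -> ((a, b) \in T1) = false.
Proof. by move=> H; apply/negP => /w1; apply/negP. Qed.

Let notin2 (a b : 'I_n) : ~~ [&& m <= a, a.+1 < b & b <= j] -> ((a, b) \in T2) = false.
Proof. by move=> H; apply/negP => /w2; apply/negP. Qed.

Let f1 (a b c : 'I_n) :
  (a, b, c) \in faces T1 -> [&& i <= a, a < b, b < c & c <= m].
Proof. by apply: face_within; case/and3P: cl1. Qed.

Let f2 (a b c : 'I_n) :
  (a, b, c) \in faces T2 -> [&& m <= a, a < b, b < c & c <= j].
Proof. by apply: face_within; case/and3P: cl2. Qed.

Lemma glue_restrl : restr (glue i j m T1 T2) i m = T1.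
Proof.
apply/setP => [[a b]]; rewrite !inE xpair_eqE -!val_eqE /=.
apply/idP/idP => [|dT]; last by have /= := w1 dT; rewrite dT; lia.
by case: (boolP (_ \in T1)) => //= _ /andP[/orP[|/w2 /=]]; lia.
Qed.

Lemma glue_restrr : restr (glue i j m T1 T2) m j = T2.
Proof.
apply/setP => [[a b]]; rewrite !inE xpair_eqE -!val_eqE /=.
apply/idP/idP => [|dT]; last by have /= := w2 dT; rewrite dT; lia.
by case: (boolP (_ \in T2)) => //= _ /andP[/orP[|/orP[/w1 /=|]]]; lia.
Qed.

Lemma within_glue : within i j (glue i j m T1 T2).
Proof.
apply/withinP => d; rewrite !inE => /or3P[/eqP ->|/w1|/w2] /=; lia.
Qed.

Lemma big_glue (F : chord n -> nat) :
  \sum_(d in glue i j m T1 T2) F d =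
  F (i, j) + (\sum_(d in T1) F d + \sum_(d in T2) F d).
Proof.
rewrite big_setU1 ?sum_disjointU //=; last by rewrite inE notin1 ?notin2 //; lia.
rewrite -setI_eq0; apply/eqP/setP => [[a b]]; rewrite !inE; apply/negP.
by move=> /andP[/w1 /= ? /w2 /=]; lia.
Qed.

Lemma triangulates_glue : triangulates i j (glue i j m T1 T2).
Proof.
have /and3P[_ /noncrossingP n1 /eqP c1] := cl1.
have /and3P[_ /noncrossingP n2 /eqP c2] := cl2.
apply/and3P; split; first exact: within_glue.
  apply/noncrossingP => [[a b] [c d]].
  rewrite !inE /crossing => /or3P[/eqP[-> ->]|dT|dT] /or3P[/eqP[-> ->]|eT|eT] /=.
  - lia.
  - by have /= := w1 eT; lia.
  - by have /= := w2 eT; lia.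
  - by have /= := w1 dT; lia.
  - exact: n1 dT eT.
  - by have /= := w1 dT; have /= := w2 eT; lia.
  - by have /= := w2 dT; lia.
  - by have /= := w2 dT; have /= := w1 eT; lia.
  - exact: n2 dT eT.
by rewrite -sum1_card big_glue !sum1_card c1 c2; apply/eqP; lia.
Qed.

Lemma edge_gluel (a b : 'I_n) : a < b -> b <= m ->
  edge (glue i j m T1 T2) a b = edge T1 a b.
Proof.
move=> ab bm; rewrite /edge !inE xpair_eqE -!val_eqE /=.
by rewrite (notin2 (a := a)) ?orbF; [congr (_ || _); case: (_ \in _); lia|lia].
Qed.

Lemma edge_gluer (a b : 'I_n) : a < b -> m <= a ->
  edge (glue i j m T1 T2) a b = edge T2 a b.
Proof.
move=> ab bm; rewrite /edge !inE xpair_eqE -!val_eqE /=.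
by rewrite (notin1 (a := a)) ?orbF; [congr (_ || _); case: (_ \in _); lia|lia].
Qed.

Lemma edge_glue_across (a b : 'I_n) : a < m < b ->
  edge (glue i j m T1 T2) a b = (a == i) && (b == j).
Proof.
move=> amb; rewrite /edge !inE xpair_eqE (notin1 (a := a)); last by lia.
by rewrite (notin2 (a := a)) ?orbF -?val_eqE /=; lia.
Qed.

Lemma faces_glue :
  faces (glue i j m T1 T2) = (i, m, j) |: (faces T1 :|: faces T2).
Proof.
have eim : edge T1 i m by apply: triangulates_edge => //; lia.
have emj : edge T2 m j by apply: triangulates_edge => //; lia.
apply/setP => [[[a b] c]]; rewrite in_setU1 in_setU.
apply/idP/idP => [|/or3P[/eqP[-> -> ->]|abc|abc]].
- rewrite inE => /and5P[ab bc].
  have [cm|mc] := leqP c m.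
    by rewrite !edge_gluel ?[(_, _) \in faces T1]inE ?ab ?bc; try lia;
      move=> -> -> ->; rewrite orbT.
  have [ma|am] := leqP m a.
    by rewrite !edge_gluer ?[(_, _) \in faces T2]inE ?ab ?bc; try lia;
      move=> -> -> ->; rewrite !orbT.
  rewrite (@edge_glue_across a c) ?am // => eab ebc /andP[/eqP ea /eqP ec]; subst a c.
  rewrite !xpair_eqE !eqxx andbT /= (_ : b == m) //.
  case: (ltngtP b m) => [bm|mb|/val_inj -> //].
    by move: ebc; rewrite edge_glue_across ?bm // -!val_eqE /=; lia.
  by move: eab; rewrite edge_glue_across ?am // -!val_eqE /=; lia.
- rewrite inE (@edge_gluel i m) ?(@edge_gluer m j) ?eim ?emj; try lia.
  by rewrite edge_glue_across ?imj ?eqxx //; case/andP: imj => -> ->.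
- have := f1 abc; move: abc; rewrite !inE => /and5P[ab bc e1 e2 e3] H.
  by rewrite !edge_gluel ?e1 ?e2 ?e3 ?ab ?bc; lia.
- have := f2 abc; move: abc; rewrite !inE => /and5P[ab bc e1 e2 e3] H.
  by rewrite !edge_gluer ?e1 ?e2 ?e3 ?ab ?bc; lia.
Qed.

Lemma sum_faces_glue (F : triangle n -> nat) :
  \sum_(t in faces (glue i j m T1 T2)) F t =
  F (i, m, j) + (\sum_(t in faces T1) F t + \sum_(t in faces T2) F t).
Proof.
rewrite faces_glue big_setU1 ?sum_disjointU //=.
  rewrite -setI_eq0; apply/eqP/setP => [[[a b] c]]; rewrite in_setI in_set0.
  by apply/negP => /andP[/f1 ? /f2]; lia.
by rewrite in_setU; apply/negP => /orP[/f1|/f2]; lia.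
Qed.

End Glue.

Definition degree T i : nat := \sum_(d in T) (d.1 == i).

Lemma degree0 i j T : within i j T -> forall k : 'I_n, k < i -> degree T k = 0.
Proof.
move=> /withinP w k ki; apply: big1 => d /w; case: eqP => [->|//]; lia.
Qed.

Lemma degree_glue i j m T1 T2 : i < m < j -> triangulates i m T1 -> triangulates m j T2 ->
  degree (glue i j m T1 T2) i = (degree T1 i).+1.
Proof.
move=> imj cl1 cl2; rewrite /degree big_glue // eqxx add1n; congr _.+1.
by rewrite [X in _ + X](@degree0 m j) ?addn0 //; [case/and3P: cl2|lia].
Qed.

Lemma triangulates_faces i j T : i < j -> triangulates i j T ->
  #|faces T| = j - i - 1 /\ \sum_(t in faces T) (t.1.1 == i) = degree T i.
Proof.
move Dk: (j - i) => k; elim/ltn_ind: k => k IH in i j T Dk *.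
move=> ltij clT; have [ltij1|leji] := ltnP i.+1 j; last first.
  have /and3P[w _ _] := clT; have Tw := elimT (withinP _ _ _) w.
  rewrite /degree (_ : faces T = set0); last first.
    by apply/setP => [[[a b] c]]; rewrite [RHS]inE; apply/negP => /(face_within w); lia.
  rewrite cards0 big_set0; split; first lia.
  by rewrite big1 // => d /Tw; lia.
have [m imj [cl1 cl2 ET]] := triangulates_restr ltij1 clT.
have [||c1 s1] := IH (m - i) _ i m _ erefl _ cl1; try lia.
have [||c2 s2] := IH (j - m) _ m j _ erefl _ cl2; try lia.
rewrite ET degree_glue //; split.
  by rewrite -sum1_card sum_faces_glue // !sum1_card c1 c2; lia.
rewrite sum_faces_glue //= eqxx s1 [X in _ + (_ + X)]big1 ?addn0 // => [[[a b] c]].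
by have /and3P[w _ _] := cl2; move=> /(face_within w) H; rewrite -val_eqE /=; lia.
Qed.

Definition triple : finType := ('I_n * {set chord n} * {set chord n})%type.

Definition parts i j : {set triple} := [set x : triple |
  [&& i < x.1.1 < j, triangulates i x.1.1 x.1.2 & triangulates x.1.1 j x.2]].

Definition glue3 i j (x : triple) := glue i j x.1.1 x.1.2 x.2.

Lemma glue_apex_le i j m m' T1 T2 T1' T2' :
  i < m < j -> triangulates i m T1 -> triangulates m j T2 ->
  i < m' < j -> triangulates i m' T1' -> triangulates m' j T2' ->
  glue i j m T1 T2 = glue i j m' T1' T2' -> m' <= m.
Proof.
move=> imj cl1 cl2 imj' cl1' cl2' E; rewrite leqNgt; apply/negP => mm'.
have : edge T1' i m' by apply: triangulates_edge => //; lia.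
rewrite -(edge_gluel imj' cl1' cl2') -?E ?(edge_glue_across imj cl1 cl2) -?val_eqE /=; lia.
Qed.

Lemma glue3_inj i j : {in parts i j &, injective (glue3 i j)}.
Proof.
move=> [[m T1] T2] [[m' T1'] T2']; rewrite !inE /= => /and3P[imj cl1 cl2].
move=> /and3P[imj' cl1' cl2']; rewrite /glue3 /= => E.
have em : m = m'.
  apply/val_inj/eqP; rewrite eqn_leq (glue_apex_le imj cl1 cl2 imj' cl1' cl2' E).
  by rewrite (glue_apex_le imj' cl1' cl2' imj cl1 cl2 (esym E)).
subst m'; congr (_, _, _).
  by rewrite -(glue_restrl imj cl1 cl2) E (glue_restrl imj cl1' cl2').
by rewrite -(glue_restrr imj cl1 cl2) E (glue_restrr imj cl1' cl2').
Qed.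

Lemma triangulates_imset i j : i.+1 < j ->
  [set T | triangulates i j T] = glue3 i j @: parts i j.
Proof.
move=> ltij; apply/setP => T; rewrite inE; apply/idP/imsetP.
  move=> /(triangulates_restr ltij)[m imj [cl1 cl2 ET]].
  by exists (m, restr T i m, restr T m j); rewrite ?inE ?imj ?cl1.
by case=> [[[m T1] T2]]; rewrite inE => /and3P[/= imj cl1 cl2] ->; apply: triangulates_glue.
Qed.

Lemma triangulates_base i j T : i < j -> j <= i.+1 -> triangulates i j T = (T == set0).
Proof.
move=> ltij leji; apply/idP/eqP => [/and3P[_ _ /eqP cT]|->].
  by apply/eqP; rewrite -cards_eq0 cT; lia.
rewrite /triangulates cards0; apply/and3P; split; last by lia.
  by apply/withinP => d; rewrite inE.
by apply/noncrossingP => d e; rewrite inE.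
Qed.

Local Open Scope ring_scope.

Lemma sum_closed_rec (F : nmodType) (f : nat -> F) i j : (i.+1 < j)%N ->
  \sum_(T in [set T | triangulates i j T]) f (degree T i) =
  \sum_(m : 'I_n | (i < m < j)%N)
    \sum_(T1 in [set T | triangulates i m T])
      (f (degree T1 i).+1 *+ #|[set T | triangulates m j T]|).
Proof.
move=> ltij; rewrite triangulates_imset // big_imset /=; last exact: glue3_inj.
under [RHS]eq_bigr => m _ do under eq_bigr => T1 _ do rewrite -sumr_const.
under [RHS]eq_bigr => m _ do rewrite pair_big /=.
rewrite pair_big_dep /=.
rewrite (reindex (fun x : 'I_n * ({set chord n} * {set chord n}) => (x.1, x.2.1, x.2.2))) /=.
  apply: eq_big => [[m [T1 T2]]|[m [T1 T2]]]; first by rewrite !inE.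
  by rewrite inE => /and3P[imj cl1 cl2]; rewrite degree_glue.
by exists (fun x => (x.1.1, (x.1.2, x.2))) => [[? []]|[[]]].
Qed.

Lemma sum_between (F : nmodType) (G : nat -> F) i j :
  \sum_(m : 'I_n | (i < m < j)%N) G m = \sum_(a < j - i - 1) G (a + i.+1)%N.
Proof.
transitivity (\sum_(i.+1 <= m < nat_of_ord j) G m).
  rewrite -(big_mkord (fun m : nat => (i < m < j)%N) G).
  by rewrite [RHS](@big_nat_widenl _ _ _ _ 0) // [RHS](@big_nat_widen _ _ _ _ _ n) ?(ltnW (ltn_ord j)).
by rewrite -[i.+1]add0n big_addn big_mkord add0n -subnDA addn1.
Qed.

Lemma sum_closed (F : nmodType) (f : nat -> F) i j : (i < j)%N ->
  \sum_(T in [set T | triangulates i j T]) f (degree T i) =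
  \sum_(s < j - i) f s *+ ballot (j - i - 1) s.
Proof.
move Dk: (j - i)%N => k; elim/ltn_ind: k => k IH in F f i j Dk *.
move=> ltij; have [ltij1|leji] := ltnP i.+1 j; last first.
  rewrite (_ : k = 1%N) ?subnn ?big_ord1; last lia.
  rewrite (big_pred1 set0) => [|T]; last by rewrite inE triangulates_base.
  by rewrite /degree big_set0.
rewrite sum_closed_rec //.
have cardE (m : 'I_n) : (i < m < j)%N -> #|[set T | triangulates m j T]| = catalan_nat (j - m - 1)%N.
  move=> imj; rewrite -sum1_card.
  have := IH (j - m)%N ltac:(lia) nat (fun=> 1%N) m j erefl ltac:(lia).
  case Ejm: (j - m)%N => [|p] -> ; first by lia.
  by rewrite subSS subn0 -sum_ballot; apply: eq_bigr => s _; exact: natn.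
have [N EN] : exists N, k = N.+2 by exists (k - 2)%N; lia.
pose G (m : nat) := \sum_(s < N.+1) f s.+1 *+ (ballot (m - i - 1)%N s * catalan_nat (j - m - 1)%N).
transitivity (\sum_(m : 'I_n | (i < m < j)%N) G m).
  apply: eq_bigr => m imj; rewrite cardE // sumrMnl.
  rewrite (IH (m - i)%N ltac:(lia) F (fun s => f s.+1) i m erefl) -?sumrMnl; last lia.
  rewrite (big_ord_widen N.+1 (fun s => f s.+1 *+ ballot (m - i - 1)%N s *+ catalan_nat (j - m - 1)%N)); last lia.
  rewrite big_mkcond; apply: eq_bigr => s _; case: ifP => [_|ge]; first by rewrite mulrnA.
  by rewrite ballot_gt //; lia.
rewrite (sum_between G) EN (_ : (j - i - 1 = N.+1)%N); last lia.
rewrite [RHS]big_ord_recl subSS subn0 (_ : ballot N.+1 0 = 0%N) // mulr0n add0r exchange_big.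
apply: eq_bigr => s _; rewrite lift0 ballot_conv -sumrMnr; apply: eq_bigr => a _.
by congr (_ *+ (ballot _ _ * catalan_nat _)); lia.
Qed.

End Triangulates.

Lemma sum_indicator (I : finType) (A : {set I}) (P : pred I) :
  #|[set x in A | P x]| = \sum_(x in A) P x.
Proof.
rewrite -sum1dep_card big_mkcondr; apply: eq_bigr => x _; by case: (P x).
Qed.

Section RootChord.
Variable p : nat.
Local Notation n := p.+3.
Implicit Types (a b c : 'I_n) (T : {set chord n}).

Definition root_chord : chord n := (ord0, ord_max).

Lemma adjacentE a b : a < b ->
  adjacent a b = (b == a.+1 :> nat) || ((a, b) == root_chord).
Proof.
move=> ltab; rewrite /adjacent /root_chord xpair_eqE -!val_eqE /=.
have ltb := ltn_ord b; rewrite [a.+1 %% _]modn_small; last by apply: leq_trans ltb.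
have [->|ne] := eqVneq (b : nat) p.+2; first by rewrite modnn andbT.
by rewrite modn_small; lia.
Qed.

Lemma segmentE T a b : a < b -> segment T a b = edge (root_chord |: T) a b.
Proof. by move=> ltab; rewrite /segment /edge adjacentE // in_setU1 orbA. Qed.

Lemma trianglesE T : triangles T = faces (root_chord |: T).
Proof.
apply/setP => [[[a b] c]]; rewrite !inE.
have [ab|//] := boolP (a < b); have [bc|//] := boolP (b < c).
by rewrite !segmentE // (ltn_trans ab bc).
Qed.

Lemma diagonalE a b : diagonal (a, b) = (a.+1 < b) && ((a, b) != root_chord).
Proof.
rewrite /diagonal /=; have [ab|] := ltnP a b; last by lia.
by rewrite adjacentE // negb_or [a.+1 < b]ltn_neqAle ab andbT eq_sym.
Qed.

Lemma triangulationE T : (T \in triangulations n) =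
  (root_chord \notin T) && triangulates ord0 ord_max (root_chord |: T).
Proof.
rewrite inE; apply/and4P/andP.
  case=> /'forall_implyP dT ncT /eqP cT _.
  have rT : root_chord \notin T.
    by apply/negP => /dT; rewrite diagonalE eqxx andbF.
  split=> //; apply/and3P; split.
  - apply/withinP => [[a b]] /setU1P[[-> ->]|/dT]; first by rewrite /= leqnn.
    by rewrite diagonalE /= => /andP[-> _]; rewrite -ltnS ltn_ord.
  - have {}ncT := elimT (noncrossingP T) ncT.
    apply/noncrossingP => [[a b] [c d]].
    have la := ltn_ord a; have lb := ltn_ord b.
    have lc := ltn_ord c; have ld := ltn_ord d.
    move=> /setU1P[[-> ->]|abT] /setU1P[[-> ->]|cdT]; last exact: ncT abT cdT.
    + by rewrite /crossing /=; lia.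
    + by rewrite /crossing /=; lia.
    + by rewrite /crossing /=; lia.
  - by rewrite cardsU1 rT cT /=; apply/eqP; lia.
case=> rT cl; have [fT _] := triangulates_faces (isT : @ord0 n.-1 < @ord_max n.-1) cl.
have /and3P[/withinP w ncT cT] := cl; split.
- apply/'forall_implyP => [[a b]] abT; rewrite diagonalE.
  have /= := w (a, b); rewrite in_setU1 abT orbT => /(_ isT)/andP[-> _] /=.
  by apply: contraNneq rT => <-.
- by apply: noncrossingS ncT; apply: subsetU1.
- by move: cT; rewrite cardsU1 rT /=; lia.
- by rewrite trianglesE fT; apply/eqP => /=; lia.
Qed.

Lemma num_triangles_v1E T : T \in triangulations n ->
  num_triangles_v1 T = degree (root_chord |: T) ord0.
Proof.
rewrite triangulationE => /andP[_ cl].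
have [_ <-] := triangulates_faces (isT : @ord0 n.-1 < @ord_max n.-1) cl.
rewrite /num_triangles_v1 sum_indicator trianglesE; apply: eq_bigr => [[[a b] c]].
rewrite inE => /and5P[ab bc _ _ _]; rewrite /is_v1 -val_eqE /=; congr nat_of_bool.
by lia.
Qed.

Lemma num_diagonals_v1E T : T \in triangulations n ->
  (num_diagonals_v1 T).+1 = degree (root_chord |: T) ord0.
Proof.
rewrite triangulationE => /andP[rT /and3P[/withinP w _ _]].
rewrite /degree big_setU1 //= add1n; congr _.+1.
rewrite /num_diagonals_v1 sum_indicator; apply: eq_bigr => [[a b]] abT.
have /= := w (a, b); rewrite in_setU1 abT orbT => /(_ isT) H.
by rewrite /is_v1 -val_eqE /=; congr nat_of_bool; lia.
Qed.

Local Open Scope ring_scope.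

Lemma sum_triangulations3 (F : nmodType) (f : nat -> F) :
  \sum_(T in triangulations n) f (num_triangles_v1 T) =
  \sum_(s < p.+2) f s *+ ballot p.+1 s.
Proof.
transitivity (\sum_(T in [set T | triangulates (ord0 : 'I_n) ord_max T]) f (degree T ord0)).
  rewrite [RHS](reindex_onto (fun T => root_chord |: T) (fun T => T :\ root_chord)) /=; last first.
    move=> T; rewrite inE => cl; apply: setD1K.
    by have /orP[] := triangulates_edge (isT : @ord0 n.-1 < @ord_max n.-1)%N cl.
  apply: eq_big => T; last by move=> /num_triangles_v1E ->.
  rewrite triangulationE inE andbC; congr (_ && _).
  apply/idP/eqP => [/setU1K //|<-].
  by rewrite !inE eqxx.
by rewrite sum_closed //= subn0 subn1.
Qed.

End RootChord.

Lemma triangulations2 : triangulations 2 = [set set0].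
Proof.
apply/setP => T; rewrite !inE; apply/and4P/eqP => [[_ _ /eqP cT _]|->].
  by apply/eqP; rewrite -cards_eq0 cT.
have t0 : triangles (set0 : {set chord 2}) = set0.
  apply/setP => [[[[a la] [b lb]] [c lc]]]; rewrite [RHS]inE.
  by apply/negbTE/negP; rewrite inE => /and5P[/= ab bc _ _ _]; lia.
rewrite t0 !cards0; split=> //.
  by apply/'forall_implyP => d; rewrite inE.
by apply/'forall_implyP => d; rewrite inE.
Qed.

Local Open Scope ring_scope.

Lemma sum_triangulations (F : nmodType) (f : nat -> F) n : (2 <= n)%N ->
  \sum_(T in triangulations n) f (num_triangles_v1 T) =
  \sum_(s < n.-1) f s *+ ballot (n - 2) s.
Proof.
case: n => [|[|[|p]]] // _; last exact: sum_triangulations3.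
rewrite triangulations2 big_set1 big_ord1 /num_triangles_v1 (_ : #|_| = 0%N) //.
apply/eqP; rewrite cards_eq0; apply/eqP/setP => [[[[a la] [b lb]] [c lc]]].
rewrite [RHS]inE; apply/negbTE/negP.
by rewrite !inE => /andP[/and5P[/= ab bc _ _ _]]; lia.
Qed.

Lemma card_triangulations n : (2 <= n)%N -> #|triangulations n| = catalan_nat (n - 2).
Proof.
move=> n2; rewrite -sum1_card.
have := @sum_triangulations nat (fun=> 1%N) n n2; case: n n2 => [|[|n]] // _ ->.
by rewrite subSS subSS subn0 -sum_ballot; apply: eq_bigr => s _; exact: natn.
Qed.

Lemma catalanE (F : numFieldType) N : catalan F N = (catalan_nat N)%:R.
Proof.
have H : (N.+1 * catalan_nat N = 'C(2 * N, N))%N.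
  have f0 : (0 < N`! * N`!)%N by rewrite muln_gt0 fact_gt0.
  apply/eqP; rewrite -(eqn_pmul2r f0); apply/eqP.
  have := @bin_fact (2 * N) N ltac:(lia); rewrite (_ : 2 * N - N = N)%N; last lia.
  by move=> ->; rewrite -catalan_nat_fact factS; ring.
by rewrite /catalan -H natrM mulKf // pnatr_eq0.
Qed.

Lemma ballotE (F : numFieldType) N s : (s <= N.+1)%N ->
  (ballot N.+1 s)%:R = s%:R * ((2 * N + 1 - s)`!)%:R /
    (((N.+1 - s)`!)%:R * ((N.+1)`!)%:R) :> F.
Proof.
move=> les; rewrite -!natrM -(ballot_fact les) -mulnA natrM mulfK //.
by rewrite pnatr_eq0 -lt0n muln_gt0 !fact_gt0.
Qed.

(* Summation by parts in the recurrence [ballot_rec]; f = id and f = square give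
   the first two moments as combinations of consecutive Catalan numbers. *)
Lemma ballot_parts (F : zmodType) (f : nat -> F) N : f 0%N = 0 ->
  \sum_(t < N.+1) f t.+1 *+ ballot N t =
  \sum_(s < N.+2) (f s - f s.-1) *+ ballot N.+1 s.
Proof.
move=> f0; rewrite [RHS]big_ord_recl (_ : ballot _ 0 = 0%N) // mulr0n add0r.
under [RHS]eq_bigr => s _ do rewrite lift0 mulrnBl.
rewrite sumrB.
have -> : \sum_(s < N.+1) f s.+1.-1 *+ ballot N.+1 s.+1 =
          \sum_(s < N.+1) f s.+1 *+ ballot N.+1 s.+2.
  rewrite [LHS]big_ord_recl [RHS]big_ord_recr (@ballot_gt N.+1 N.+2) // mulr0n [RHS]addr0.
  by rewrite [f _]f0 mul0rn [LHS]add0r.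
rewrite -sumrB; apply: eq_bigr => s _.
by rewrite ballot_rec mulrnDr addrK.
Qed.

Lemma sum_ballot_const (F : pzRingType) N :
  \sum_(s < N.+1) 1 *+ ballot N s = (catalan_nat N)%:R :> F.
Proof. by rewrite -sum_ballot natr_sum. Qed.

Lemma sum_ballot_id (F : pzRingType) N :
  \sum_(s < N.+1) s%:R *+ ballot N s = (catalan_nat N.+1)%:R - (catalan_nat N)%:R :> F.
Proof.
have := @ballot_parts F (fun s => s%:R) N erefl.
under eq_bigr => s _ do rewrite -natr1 mulrnDl.
rewrite big_split /= sum_ballot_const => E; apply: (addIr (catalan_nat N)%:R).
rewrite E subrK -sum_ballot_const [LHS]big_ord_recl [RHS]big_ord_recl.
rewrite !mulr0n; congr (_ + _); apply: eq_bigr => s _.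
by rewrite lift0 -natr1 addrAC subrr add0r.
Qed.

Lemma sum_ballot_sqr (F : comPzRingType) N :
  \sum_(s < N.+1) s%:R ^+ 2 *+ ballot N s =
  2 * (catalan_nat N.+2)%:R - 5 * (catalan_nat N.+1)%:R + (catalan_nat N)%:R :> F.
Proof.
have := @ballot_parts F (fun s => s%:R ^+ 2) N (expr0n _ _).
rewrite (eq_bigr (fun t : 'I_N.+1 => t%:R ^+ 2 *+ ballot N t +
    (t%:R *+ ballot N t + t%:R *+ ballot N t) + 1 *+ ballot N t)); last first.
  by move=> t _; rewrite -natr1 -!mulrnDl; congr (_ *+ _); ring.
rewrite [RHS](eq_bigr (fun s : 'I_N.+2 => s%:R *+ ballot N.+1 s +
    s%:R *+ ballot N.+1 s - 1 *+ ballot N.+1 s)); last first.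
  move=> [[|s] lts] _; first by rewrite !mulr0n !addr0 subr0.
  by rewrite -mulNrn -!mulrnDl /= -natr1; congr (_ *+ _); ring.
rewrite !big_split /= sumrN !sum_ballot_id !sum_ballot_const => E.
move: E; set X := \sum_(_ < _) _; set d := _ - _; set c := (catalan_nat N)%:R => E.
have -> : X = X + (d + d) + c - (d + d) - c by ring.
by rewrite E /d -/c; ring.
Qed.

Lemma unif_expectation_v1 (F : numFieldType) (f : nat -> F) N :
  unif_expectation (triangulations N.+2) (fun T => f (num_triangles_v1 T)) =
  (\sum_(s < N.+1) f s *+ ballot N s) / (catalan_nat N)%:R.
Proof.
by rewrite /unif_expectation sum_triangulations // card_triangulations // !subSS !subn0.
Qed.

Lemma mean_v1E (R : realType) N :
  mean_v1 R N.+2 = ((catalan_nat N.+1)%:R - (catalan_nat N)%:R) / (catalan_nat N)%:R.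
Proof. by rewrite /mean_v1 unif_expectation_v1 sum_ballot_id. Qed.

Lemma var_v1E (R : realType) N :
  var_v1 R N.+2 =
  (2 * (catalan_nat N.+2)%:R - 5 * (catalan_nat N.+1)%:R + (catalan_nat N)%:R) / (catalan_nat N)%:R
  - mean_v1 R N.+2 ^+ 2.
Proof.
rewrite /var_v1 /unif_variance -/(mean_v1 R N.+2).
rewrite (unif_expectation_v1 (fun s => (s%:R - mean_v1 R N.+2) ^+ 2)).
have c0 : (catalan_nat N)%:R != 0 :> R by rewrite pnatr_eq0 -lt0n catalan_nat_gt0.
have -> : \sum_(s < N.+1) (s%:R - mean_v1 R N.+2) ^+ 2 *+ ballot N s =
  \sum_(s < N.+1) s%:R ^+ 2 *+ ballot N s
  - 2 * mean_v1 R N.+2 * (\sum_(s < N.+1) s%:R *+ ballot N s)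
  + mean_v1 R N.+2 ^+ 2 * (\sum_(s < N.+1) 1 *+ ballot N s).
  rewrite !mulr_sumr -sumrB -big_split /=; apply: eq_bigr => s _.
  by rewrite !mulrnAr -mulrnBl -mulrnDl; congr (_ *+ _); ring.
rewrite sum_ballot_sqr sum_ballot_id sum_ballot_const mean_v1E.
by field.
Qed.

Lemma catalan_nat_ratio (F : numFieldType) N :
  (catalan_nat N.+1)%:R = 2 * (2 * N%:R + 1) / (N%:R + 2) * (catalan_nat N)%:R :> F.
Proof.
have nz : N%:R + 2 != 0 :> F by rewrite -natrD pnatr_eq0 addn2.
apply: (mulfI nz); have := congr1 (fun m => m%:R : F) (catalan_natS N).
by rewrite /= !natrM natrD natrM -addn2 natrD => ->; field.
Qed.

Theorem lemma5 (R : realType) :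
  (forall n : nat, (3 <= n)%N ->
     forall T : {set chord n}, T \in triangulations n ->
       num_triangles_v1 T = (num_diagonals_v1 T + 1)%N) /\
  (forall n : nat, (4 <= n)%N -> forall z : R[i],
     pgf_v1 n z =
       (catalan _ (n - 2))^-1 *
       \sum_(1 <= s < (n - 2).+1)
          (s%:R * ((2 * n - s - 5)`!)%:R
             / (((n - s - 2)`!)%:R * ((n - 2)`!)%:R)) * z ^+ s) /\
  (forall n : nat, (2 <= n)%N ->
     mean_v1 R n = 3 * (n%:R - 2) / n%:R) /\
  (forall n : nat, (2 <= n)%N ->
     var_v1 R n =
       2 * (2 * n%:R - 3) * (n%:R - 2) * (n%:R - 3)
         / (n%:R ^+ 2 * (n%:R + 1))).
Proof.
have n2E N : N.+2%:R = N%:R + 2 :> R by rewrite -addn2 natrD.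
have nz k N : k.+1%:R + N%:R != 0 :> R by rewrite -natrD pnatr_eq0.
split; last split; last split.
- move=> [|[|[|p]]] // _ T TT.
  by rewrite num_triangles_v1E // -num_diagonals_v1E // addn1.
- move=> [|[|[|[|p]]]] // _ z.
  rewrite /pgf_v1 (unif_expectation_v1 (fun s => z ^+ s)) catalanE !subSS subn0 mulrC.
  congr (_ * _); rewrite big_add1 big_mkord big_ord_recl mulr0n add0r.
  apply: eq_bigr => s _; rewrite lift0 -[LHS]mulr_natl ballotE //.
  by congr (_ * _`!%:R / (_`!%:R * _) * _); move: (nat_of_ord s) => t; lia.
- move=> [|[|N]] // _; rewrite mean_v1E catalan_nat_ratio n2E.
  have c0 : (catalan_nat N)%:R != 0 :> R by rewrite pnatr_eq0 -lt0n catalan_nat_gt0.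
  by field; rewrite c0 (nz 1%N).
- move=> [|[|N]] // _; rewrite var_v1E mean_v1E !catalan_nat_ratio n2E -natr1.
  have c0 : (catalan_nat N)%:R != 0 :> R by rewrite pnatr_eq0 -lt0n catalan_nat_gt0.
  have e3 : 2 + N%:R + 1 = 3 + N%:R :> R by ring.
  by field; rewrite c0 e3 (nz 1%N) (nz 2%N).
Qed.
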